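(* Let $m,n\ge1$ be integers and let $P\in\mathbb{R}$ be such that $0\le P\le n^2<m^2$. Then there exist $0<E_1\le E_2<\infty$ such that $\Theta_m$ is linearly stable with respect to $\Theta_n$ whenever $0<E_{\Theta_m}\le E_1$ or $E_{\Theta_m}>E_2$.
   Context: $\Theta_m$ denotes any solution $\Theta_m:\mathbb{R}\to\mathbb{R}$ of the Duffing equation $$\ddot{\Theta}_m(t)+m^2(m^2-P)\Theta_m(t)+m^4\Theta_m(t)^3=0 ,$$ and its (constant) energy is $$E_{\Theta_m}=\frac{\dot{\Theta}_m(0)^2}{2}+\frac{m^2(m^2-P)}{2}\Theta_m(0)^2+\frac{m^4}{4}\Theta_m(0)^4 .$$ The assertion holds for every solution $\Theta_m$ whose energy lies in the indicated range. $\Theta_m$ is said to be linearly stable (unstable) with respect to the $n$-th mode $\Theta_n$ if $\xi\equiv0$ is a stable (unstable) solution of the Hill equation $$\ddot{\xi}+a(t)\xi=0,\qquad a(t)=n^2(n^2-P)+m^2n^2\Theta_m(t)^2 ;$$ stability of $\xi\equiv0$ is equivalent to all solutions $\xi$ being bounded on $\mathbb{R}$, and unstable means not stable. *)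

(* Defs.v *)
From Stdlib Require Import Reals.
From Coquelicot Require Import Coquelicot.
Open Scope R_scope.

(* [x] is twice differentiable on the whole line, with second derivative [y];
   [Derive] is total, so both derivatives are asserted to exist. *)
Definition second_derivative (x y : R -> R) : Prop :=
  forall t : R, is_derive x t (Derive x t) /\ is_derive (Derive x) t (y t).

Definition duffing_solution (m : nat) (P : R) (Theta : R -> R) : Prop :=
  second_derivative Theta
    (fun t => - (INR m ^ 2 * (INR m ^ 2 - P) * Theta t
                 + INR m ^ 4 * Theta t ^ 3)).

Definition duffing_energy (m : nat) (P : R) (Theta : R -> R) : R :=
  Derive Theta 0 ^ 2 / 2
  + INR m ^ 2 * (INR m ^ 2 - P) / 2 * Theta 0 ^ 2
  + INR m ^ 4 / 4 * Theta 0 ^ 4.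

Definition hill_solution (a xi : R -> R) : Prop :=
  second_derivative xi (fun t => - (a t * xi t)).

(* Lyapunov stability of the zero solution in the phase plane (xi, xi').
   The smallness is required for all t in R, past as well as future, in
   accordance with the equivalence between stability and boundedness of all
   solutions on R; for periodic [a] it is the same as asking it for t >= t0. *)
Definition hill_zero_stable (a : R -> R) : Prop :=
  forall t0 eps : R, 0 < eps ->
  exists delta : R, 0 < delta /\
    forall xi : R -> R, hill_solution a xi ->
      Rabs (xi t0) < delta -> Rabs (Derive xi t0) < delta ->
      forall t : R, Rabs (xi t) < eps /\ Rabs (Derive xi t) < eps.

Definition hill_coefficient (m n : nat) (P : R) (Theta : R -> R) (t : R) : R :=
  INR n ^ 2 * (INR n ^ 2 - P) + INR m ^ 2 * INR n ^ 2 * Theta t ^ 2.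

Definition linearly_stable (m n : nat) (P : R) (Theta : R -> R) : Prop :=
  hill_zero_stable (hill_coefficient m n P Theta).

(* Main.v *)
(** Every positive energy gives stability. Let [c] be a critical point of Theta with
    [Theta c > 0] and [h] the next zero of Theta. By uniqueness for the Duffing
    equation, the Hill coefficient [a] is even about both [c] and [h]. Moreover
    [0 < a < b] on [(c, h)], where [b] is the coefficient for which
    [Theta'' + b Theta = 0]. A Sturm comparison with Theta shows that the Hill
    solution with data (1, 0) at [c] has data of signs (+, -) at [h]; a comparison
    with [- Theta'] shows that the one with data (0, 1) has data of signs (+, +).
    These signs yield a positive definite quadratic form in [(xi, xi')] taking the
    same value at all points [c + 2 k (h - c)], and Gronwall's inequality controls
    xi in between. *)
Require Import Defs.
From Stdlib Require Import Reals Lra Psatz Classical.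
From Coquelicot Require Import Coquelicot.
Open Scope R_scope.

(** * Real analysis: monotonicity and first zeros *)

Lemma derive_pos_lt (f df : R -> R) (u v : R) :
  u < v -> (forall t, is_derive f t (df t)) ->
  (forall t, u < t < v -> 0 < df t) -> f u < f v.
Proof.
  intros Huv Hd Hp.
  destruct (MVT_cor2 f df u v Huv) as [x [Hx Hxuv]].
  { intros t _. apply is_derive_Reals, Hd. }
  specialize (Hp x Hxuv). nra.
Qed.

Lemma derive_neg_lt (f df : R -> R) (u v : R) :
  u < v -> (forall t, is_derive f t (df t)) ->
  (forall t, u < t < v -> df t < 0) -> f v < f u.
Proof.
  intros Huv Hd Hp.
  destruct (MVT_cor2 f df u v Huv) as [x [Hx Hxuv]].
  { intros t _. apply is_derive_Reals, Hd. }
  specialize (Hp x Hxuv). nra.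
Qed.

Lemma derive_nonneg_le (f df : R -> R) (u v : R) :
  u <= v -> (forall t, is_derive f t (df t)) ->
  (forall t, 0 <= df t) -> f u <= f v.
Proof.
  intros Huv Hd Hp.
  destruct Huv as [Huv | ->]; [| lra].
  destruct (MVT_cor2 f df u v Huv) as [x [Hx Hxuv]].
  { intros t _. apply is_derive_Reals, Hd. }
  specialize (Hp x). nra.
Qed.

Lemma continuous_gt_nbhd (f : R -> R) (z k : R) :
  continuous f z -> k < f z ->
  exists d : R, 0 < d /\ forall t, Rabs (t - z) < d -> k < f t.
Proof.
  intros Hc Hk.
  destruct (proj1 (filterlim_locally f (f z)) Hc
              (mkposreal (f z - k) ltac:(lra))) as [d Hd].
  exists d; split; [apply cond_pos|].
  intros t Ht. specialize (Hd t Ht).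
  change (Rabs (f t - f z) < f z - k) in Hd.
  apply Rabs_def2 in Hd. lra.
Qed.

(** The zero is the supremum of the times up to which [f] has stayed positive; continuity rules out
    either strict sign there. *)
Lemma first_zero (f : R -> R) (u v : R) :
  (forall t, continuous f t) -> u < v -> 0 < f u -> f v <= 0 ->
  exists z, u < z <= v /\ f z = 0 /\ forall t, u <= t < z -> 0 < f t.
Proof.
  intros Hc Huv Hu Hv.
  set (A := fun t => u <= t <= v /\ forall s, u <= s <= t -> 0 < f s).
  destruct (completeness A) as [z [Hub Hlub]].
  { exists v. intros t [Ht _]. lra. }
  { exists u. split; [lra|]. intros s Hs. replace s with u by lra. exact Hu. }
  assert (Huz : u <= z).
  { apply Hub. split; [lra|]. intros s Hs. replace s with u by lra. exact Hu. }
  assert (Hzv : z <= v) by (apply Hlub; intros t [Ht _]; lra).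
  assert (Hbefore : forall t, u <= t < z -> 0 < f t).
  (* If [f t] is not positive, no member of [A] exceeds [t], so the supremum [z] cannot lie beyond
     [t]. *)
  { intros t Ht. apply NNPP. intros Hn.
    enough (z <= t) by lra.
    apply Hlub. intros s [_ Hs]. apply Rnot_lt_le. intros Hts.
    apply Hn, Hs. lra. }
  assert (Hz : f z = 0).
  { destruct (Rtotal_order (f z) 0) as [Hlt | [Heq | Hgt]]; [exfalso | exact Heq | exfalso].
    - assert (Hne : u <> z) by (intros ->; lra).
      destruct (continuous_gt_nbhd (fun t => - f t) z 0) as [d [Hd Hn]].
      { apply (continuous_opp f), Hc. }
      { lra. }
      set (t := Rmax u (z - d / 2)).
      assert (Ht : u <= t < z).
      { unfold t; split; [apply Rmax_l|]. apply Rmax_lub_lt; lra. }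
      specialize (Hbefore t Ht). specialize (Hn t).
      assert (z - d / 2 <= t) by apply Rmax_r.
      rewrite Rabs_left in Hn by lra. lra.
    - assert (Hne : z <> v) by (intros ->; lra).
      destruct (continuous_gt_nbhd f z 0 (Hc z) Hgt) as [d [Hd Hn]].
      set (t := Rmin v (z + d / 2)).
      assert (Ht : z < t) by (apply Rmin_glb_lt; lra).
      assert (t <= z + d / 2) by apply Rmin_r.
      assert (t <= v) by apply Rmin_l.
      enough (t <= z) by lra.
      apply Hub. split; [lra|].
      intros s Hs. destruct (Rlt_le_dec s z) as [Hsz | Hsz].
      + apply Hbefore; lra.
      + apply Hn. rewrite Rabs_right; lra. }
  exists z. split; [|split; [exact Hz | exact Hbefore]].
  split; [|exact Hzv].
  destruct Huz as [|<-]; [assumption | lra].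
Qed.

(** * Second derivatives under linear combinations and affine changes of time *)

Lemma second_derivative_intro (x dx y : R -> R) :
  (forall t, is_derive x t (dx t)) -> (forall t, is_derive dx t (y t)) ->
  second_derivative x y /\ forall t, Derive x t = dx t.
Proof.
  intros H1 H2.
  assert (H : forall t, Derive x t = dx t) by (intros t; apply is_derive_unique, H1).
  split; [|exact H].
  intros t. split.
  - rewrite H. apply H1.
  - apply (is_derive_ext dx); [intros s; symmetry; apply H | apply H2].
Qed.

Lemma second_derivative_ext (x y z : R -> R) :
  (forall t, y t = z t) -> second_derivative x y -> second_derivative x z.
Proof. intros H Hx t. rewrite <- H. apply Hx. Qed.

Lemma second_derivative_linear (k l : R) (x1 y1 x2 y2 : R -> R) :
  second_derivative x1 y1 -> second_derivative x2 y2 ->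
  second_derivative (fun t => k * x1 t + l * x2 t) (fun t => k * y1 t + l * y2 t) /\
  forall t, Derive (fun s => k * x1 s + l * x2 s) t = k * Derive x1 t + l * Derive x2 t.
Proof.
  intros H1 H2. apply second_derivative_intro; intros t.
  - apply (is_derive_plus (fun s => k * x1 s) (fun s => l * x2 s));
      apply is_derive_scal; [apply H1 | apply H2].
  - apply (is_derive_plus (fun s => k * Derive x1 s) (fun s => l * Derive x2 s));
      apply is_derive_scal; [apply H1 | apply H2].
Qed.

Lemma is_derive_comp_affine (f : R -> R) (e p t l : R) :
  is_derive f (e * t + p) l -> is_derive (fun s => f (e * s + p)) t (e * l).
Proof.
  intros H. apply (is_derive_comp f (fun s => e * s + p)); [exact H|].
  auto_derive; [easy | ring].
Qed.

Lemma second_derivative_affine (e p : R) (x y : R -> R) :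
  second_derivative x y ->
  second_derivative (fun t => x (e * t + p)) (fun t => e * (e * y (e * t + p))) /\
  forall t, Derive (fun s => x (e * s + p)) t = e * Derive x (e * t + p).
Proof.
  intros H. apply second_derivative_intro; intros t.
  - apply is_derive_comp_affine, H.
  - apply is_derive_scal, is_derive_comp_affine, H.
Qed.

Lemma second_derivative_continuous (x y : R -> R) (t : R) :
  second_derivative x y -> continuous x t /\ continuous (Derive x) t.
Proof.
  intros H. split; apply (@ex_derive_continuous R_AbsRing R_NormedModule).
  - exists (Derive x t). apply H.
  - exists (y t). apply H.
Qed.

Lemma hill_solution_linear (a x1 x2 : R -> R) (k l : R) :
  hill_solution a x1 -> hill_solution a x2 ->
  hill_solution a (fun t => k * x1 t + l * x2 t).
Proof.
  intros H1 H2.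
  apply (second_derivative_ext _ (fun t => k * - (a t * x1 t) + l * - (a t * x2 t))).
  { intros t; ring. }
  apply (second_derivative_linear k l x1 (fun t => - (a t * x1 t)) x2 (fun t => - (a t * x2 t)));
    assumption.
Qed.

(** The chain rule produces the factor [e * e]. The value [e = 1] gives translation by a period of
    [a], and [e = -1] gives reflection about [p / 2]. *)
Lemma hill_solution_affine (a x : R -> R) (e p : R) :
  e * e = 1 -> (forall t, a (e * t + p) = a t) -> hill_solution a x ->
  hill_solution a (fun t => x (e * t + p)).
Proof.
  intros He Ha H.
  apply (second_derivative_ext _ (fun t => e * (e * - (a (e * t + p) * x (e * t + p))))).
  { intros t. rewrite Ha. rewrite <- Rmult_assoc, He. ring. }
  apply (second_derivative_affine e p x (fun t => - (a t * x t))), H.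
Qed.

(** * Gronwall bound and uniqueness for Hill equations *)

Definition phase_norm (x : R -> R) (t : R) : R := x t ^ 2 + Derive x t ^ 2.

(** The derivative [2 x x' (1 - a)] of the norm is at most [1 + B] times the norm in absolute value,
    because [2 |x x'| <= x^2 + x'^2]. Hence the norm times [exp (- (1 + B) r)] is nonincreasing and
    the norm times [exp ((1 + B) r)] is nondecreasing, which covers both directions of time. *)
Lemma phase_norm_growth (a x : R -> R) (B s t : R) :
  (forall r, 0 <= a r <= B) -> hill_solution a x ->
  phase_norm x t <= phase_norm x s * exp ((1 + B) * Rabs (t - s)).
Proof.
  intros Ha Hx.
  set (dN := fun r => 2 * x r * Derive x r * (1 - a r)).
  assert (HN : forall r, is_derive (phase_norm x) r (dN r)).
  { intros r. destruct (Hx r) as [H1 H2]. unfold phase_norm, dN.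
    evar_last.
    - apply (is_derive_plus (fun t => x t ^ 2) (fun t => Derive x t ^ 2));
        apply is_derive_pow; eassumption.
    - unfold plus; simpl. ring. }
  assert (Hbd : forall r, Rabs (dN r) <= (1 + B) * phase_norm x r).
  { intros r. unfold dN, phase_norm. specialize (Ha r).
    rewrite Rabs_mult, Rmult_comm.
    apply Rmult_le_compat; try apply Rabs_pos.
    - apply Rabs_le; lra.
    - pose proof (pow2_ge_0 (x r + Derive x r)). pose proof (pow2_ge_0 (x r - Derive x r)).
      apply Rabs_le; split; lra. }
  assert (Hexp : forall e r, is_derive (fun r => phase_norm x r * exp (e * r)) r
            ((dN r + e * phase_norm x r) * exp (e * r))).
  { intros e r. evar_last.
    - apply (is_derive_mult (phase_norm x) (fun r => exp (e * r))).
      + apply HN.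
      + apply (is_derive_comp exp (fun r => e * r)).
        * apply is_derive_exp.
        * auto_derive; [easy | reflexivity].
      + intros; apply Rmult_comm.
    - unfold plus, mult, scal; simpl; unfold mult; simpl. ring. }
  assert (Hsplit : forall e u v, phase_norm x u * exp (e * u) <= phase_norm x v * exp (e * v) ->
            phase_norm x u <= phase_norm x v * exp (e * (v - u))).
  { intros e u v H. apply (Rmult_le_reg_r (exp (e * u))); [apply exp_pos|].
    rewrite Rmult_assoc, <- exp_plus. replace (e * (v - u) + e * u) with (e * v) by ring.
    exact H. }
  destruct (Rle_lt_dec s t) as [Hst | Hst].
  - rewrite Rabs_right by lra.
    replace ((1 + B) * (t - s)) with (- (1 + B) * (s - t)) by ring.
    apply Hsplit. apply Ropp_le_cancel.
    apply (derive_nonneg_le (fun r => - (phase_norm x r * exp (- (1 + B) * r)))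
             (fun r => - ((dN r + - (1 + B) * phase_norm x r) * exp (- (1 + B) * r)))); [lra| |].
    + intros r. apply (is_derive_opp (fun r => phase_norm x r * exp (- (1 + B) * r))), Hexp.
    + intros r. specialize (Hbd r). pose proof (exp_pos (- (1 + B) * r)).
      pose proof (Rle_abs (dN r)). nra.
  - rewrite Rabs_left by lra.
    replace (- (t - s)) with (s - t) by ring.
    apply Hsplit.
    apply (derive_nonneg_le (fun r => phase_norm x r * exp ((1 + B) * r))
             (fun r => (dN r + (1 + B) * phase_norm x r) * exp ((1 + B) * r))); [lra| |].
    + intros r. apply Hexp.
    + intros r. specialize (Hbd r). pose proof (exp_pos ((1 + B) * r)).
      pose proof (Rle_abs (- dN r)). rewrite Rabs_Ropp in *. nra.
Qed.

Lemma hill_unique_zero (a x : R -> R) (B s : R) :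
  (forall r, 0 <= a r <= B) -> hill_solution a x ->
  x s = 0 -> Derive x s = 0 -> forall t, x t = 0 /\ Derive x t = 0.
Proof.
  intros Ha Hx H0 H1 t.
  pose proof (phase_norm_growth a x B s t Ha Hx) as H.
  unfold phase_norm in H. rewrite H0, H1 in H.
  replace ((0 ^ 2 + 0 ^ 2) * exp ((1 + B) * Rabs (t - s))) with 0 in H by ring.
  split; nra.
Qed.

Lemma hill_unique (a x y : R -> R) (B s k : R) :
  (forall r, 0 <= a r <= B) -> hill_solution a x -> hill_solution a y ->
  x s = k * y s -> Derive x s = k * Derive y s ->
  forall t, x t = k * y t /\ Derive x t = k * Derive y t.
Proof.
  intros Ha Hx Hy H0 H1 t.
  destruct (second_derivative_linear 1 (- k) _ _ _ _ Hx Hy) as [_ HD].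
  destruct (hill_unique_zero a (fun r => 1 * x r + - k * y r) B s Ha) with (t := t) as [E0 E1].
  - apply hill_solution_linear; assumption.
  - rewrite H0. ring.
  - rewrite HD, H1. ring.
  - rewrite HD in E1. split; lra.
Qed.

(** * Sturm comparison through the Wronskian *)

Lemma wronskian_derive (a b x w : R -> R) (t : R) :
  hill_solution a x -> hill_solution b w ->
  is_derive (fun s => Derive x s * w s - x s * Derive w s) t ((b t - a t) * x t * w t).
Proof.
  intros Hx Hw. destruct (Hx t) as [D1 D2], (Hw t) as [D3 D4].
  rewrite is_derive_Reals in D1, D2, D3, D4 |- *.
  replace ((b t - a t) * x t * w t) with
    ((- (a t * x t) * w t + Derive x t * Derive w t)
     - (Derive x t * Derive w t + x t * - (b t * w t))) by ring.
  apply (derivable_pt_lim_minus (fun s => Derive x s * w s) (fun s => x s * Derive w s)).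
  - apply (derivable_pt_lim_mult (Derive x) w); assumption.
  - apply (derivable_pt_lim_mult x (Derive w)); assumption.
Qed.

(** While [x] is positive it is concave, so its slope falls below 0. At a first zero [z] of [x] the
    Wronskian [x' w - x w'] would have increased strictly from 0, yet there it equals
    [x' w <= 0]. *)
Lemma hill_even_comparison (a b w x : R -> R) (c h : R) :
  c < h -> hill_solution a x -> hill_solution b w ->
  (forall t, c < t < h -> 0 < a t < b t) ->
  (forall t, c <= t < h -> 0 < w t) -> 0 <= w h -> Derive w c = 0 ->
  x c = 1 -> Derive x c = 0 -> 0 < x h /\ Derive x h < 0.
Proof.
  intros Hch Hx Hw Hab Hwp Hwh Hwc Hx0 Hx1.
  assert (Hconc : forall z, c < z <= h -> (forall t, c <= t < z -> 0 < x t) -> Derive x z < 0).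
  { intros z Hz Hp. rewrite <- Hx1.
    apply (derive_neg_lt (Derive x) (fun t => - (a t * x t))); [lra| |].
    - intros t. apply Hx.
    - intros t Ht. specialize (Hp t ltac:(lra)). specialize (Hab t ltac:(lra)). nra. }
  assert (Hpos : forall t, c <= t <= h -> 0 < x t).
  { intros s Hs. apply Rnot_le_lt. intros Hle.
    assert (Hcs : c < s) by (destruct (proj1 Hs) as [|<-]; [assumption | lra]).
    destruct (first_zero x c s) as [z [Hz [Hxz Hp]]]; [|assumption|lra|assumption|].
    { intros t. apply (second_derivative_continuous _ _ t Hx). }
    specialize (Hconc z ltac:(lra) Hp).
    assert (HW : Derive x c * w c - x c * Derive w c < Derive x z * w z - x z * Derive w z).
    { apply (derive_pos_lt (fun t => Derive x t * w t - x t * Derive w t)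
               (fun t => (b t - a t) * x t * w t)); [lra| |].
      - intros t. apply wronskian_derive; assumption.
      - intros t Ht. specialize (Hab t ltac:(lra)). specialize (Hwp t ltac:(lra)).
        specialize (Hp t ltac:(lra)).
        apply Rmult_lt_0_compat; [apply Rmult_lt_0_compat|]; lra. }
    assert (Hwz : 0 <= w z).
    { destruct (proj2 Hz) as [Hlt | Heq].
      - apply Rlt_le, Hwp; lra.
      - destruct (proj2 Hs) as [Hlt' | Heq']; [apply Rlt_le, Hwp; lra|].
        rewrite Heq, Heq'. exact Hwh. }
    rewrite Hx1, Hwc, Hxz in HW. nra. }
  split; [apply Hpos; lra|].
  apply Hconc; [lra|]. intros t Ht. apply Hpos. lra.
Qed.

(** The comparison is now run up to a first zero [z] of [x']. The Wronskian starts at 0 and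
    increases strictly, yet at [z] it equals [- x w' <= 0]. *)
Lemma hill_odd_comparison (a b w x : R -> R) (c h : R) :
  c < h -> hill_solution a x -> hill_solution b w ->
  (forall t, c < t < h -> a t < b t) ->
  (forall t, c < t < h -> 0 < w t) -> w c = 0 ->
  (forall t, c < t <= h -> 0 <= Derive w t) ->
  x c = 0 -> Derive x c = 1 -> 0 < x h /\ 0 < Derive x h.
Proof.
  intros Hch Hx Hw Hab Hwp Hwc Hdw Hx0 Hx1.
  assert (Hinc : forall z, c < z -> (forall t, c <= t < z -> 0 < Derive x t) -> 0 < x z).
  { intros z Hz Hp. rewrite <- Hx0.
    apply (derive_pos_lt x (Derive x)); [lra| |].
    - intros t. apply Hx.
    - intros t Ht. apply Hp. lra. }
  assert (Hpos : forall t, c <= t <= h -> 0 < Derive x t).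
  { intros s Hs. apply Rnot_le_lt. intros Hle.
    assert (Hcs : c < s) by (destruct (proj1 Hs) as [|<-]; [assumption | lra]).
    destruct (first_zero (Derive x) c s) as [z [Hz [Hxz Hp]]]; [|assumption|lra|assumption|].
    { intros t. apply (second_derivative_continuous _ _ t Hx). }
    assert (Hxp : 0 < x z) by (apply Hinc; [lra | assumption]).
    assert (HW : Derive x c * w c - x c * Derive w c < Derive x z * w z - x z * Derive w z).
    { apply (derive_pos_lt (fun t => Derive x t * w t - x t * Derive w t)
               (fun t => (b t - a t) * x t * w t)); [lra| |].
      - intros t. apply wronskian_derive; assumption.
      - intros t Ht. specialize (Hab t ltac:(lra)). specialize (Hwp t ltac:(lra)).
        assert (0 < x t) by (apply Hinc; [lra | intros r Hr; apply Hp; lra]).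
        apply Rmult_lt_0_compat; [apply Rmult_lt_0_compat|]; lra. }
    specialize (Hdw z ltac:(lra)).
    rewrite Hx0, Hwc, Hxz in HW. nra. }
  split; [apply Hinc; [lra|] | apply Hpos; lra].
  intros t Ht. apply Hpos. lra.
Qed.

(** * Transfer from [c] to [h] and the invariant quadratic form *)

(* Stated with a predicate [A] and a witness for it so that no existence theorem
   for the Hill equation is needed: if no solution has data [(u, v)] at [c], then
   the multiples of [(u, v)] are only realised by [x = 0] and any [k, l] will do. *)
Lemma hill_transfer_line (a : R -> R) (B c h u v : R) (A : R -> R -> Prop) :
  (forall t, 0 <= a t <= B) -> (exists k l, A k l) ->
  (forall x, hill_solution a x -> x c = u -> Derive x c = v -> A (x h) (Derive x h)) ->
  exists k l, A k l /\
    forall r x, hill_solution a x -> x c = r * u -> Derive x c = r * v ->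
      x h = r * k /\ Derive x h = r * l.
Proof.
  intros Ha [k0 [l0 Hkl]] HA.
  destruct (classic (exists y, hill_solution a y /\ y c = u /\ Derive y c = v))
    as [[y [Hy [Hu Hv]]] | Hno].
  - exists (y h), (Derive y h). split; [apply HA; assumption|].
    intros r x Hx H0 H1. apply (hill_unique a x y B c r Ha Hx Hy); congruence.
  - exists k0, l0. split; [exact Hkl|].
    intros r x Hx H0 H1.
    destruct (Req_dec r 0) as [-> | Hr].
    + destruct (hill_unique_zero a x B c Ha Hx) with (t := h) as [-> ->]; lra.
    + exfalso. apply Hno. exists (fun t => / r * x t + 0 * x t).
      destruct (second_derivative_linear (/ r) 0 _ _ _ _ Hx Hx) as [_ HD].
      split; [apply hill_solution_linear; assumption|].
      rewrite HD, H0, H1. split; field; exact Hr.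
Qed.

(** Since [a] is even about [c], the even and odd parts of [x] about [c] are again solutions. Their
    data at [c] are [(x c, 0)] and [(0, x' c)], multiples of the two data whose signs at [h] are
    known. *)
Lemma hill_transfer (a : R -> R) (B c h : R) :
  (forall t, 0 <= a t <= B) -> (forall t, a (-1 * t + 2 * c) = a t) ->
  (forall x, hill_solution a x -> x c = 1 -> Derive x c = 0 -> 0 < x h /\ Derive x h < 0) ->
  (forall x, hill_solution a x -> x c = 0 -> Derive x c = 1 -> 0 < x h /\ 0 < Derive x h) ->
  exists c1 c2 s1 s2, 0 < c1 /\ 0 < c2 /\ 0 < s1 /\ 0 < s2 /\
    forall x, hill_solution a x ->
      x h = c1 * x c + s1 * Derive x c /\ Derive x h = - c2 * x c + s2 * Derive x c.
Proof.
  intros Ha Hc Heven Hodd.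
  destruct (hill_transfer_line a B c h 1 0 (fun k l => 0 < k /\ l < 0) Ha)
    as [c1 [l2 [[Hc1 Hl2] HC]]]; [exists 1, (-1); lra | exact Heven |].
  destruct (hill_transfer_line a B c h 0 1 (fun k l => 0 < k /\ 0 < l) Ha)
    as [s1 [s2 [[Hs1 Hs2] HS]]]; [exists 1, 1; lra | exact Hodd |].
  exists c1, (- l2), s1, s2. repeat (split; [lra|]).
  intros x Hx.
  destruct (second_derivative_affine (-1) (2 * c) _ _ Hx) as [_ HD].
  assert (Hy : hill_solution a (fun t => x (-1 * t + 2 * c))).
  { apply hill_solution_affine; [ring | assumption | assumption]. }
  destruct (second_derivative_linear (/ 2) (/ 2) _ _ _ _ Hx Hy) as [_ HDe].
  destruct (second_derivative_linear (/ 2) (- / 2) _ _ _ _ Hx Hy) as [_ HDo].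
  destruct (HC (x c) (fun t => / 2 * x t + / 2 * x (-1 * t + 2 * c))) as [E0 E1].
  { apply hill_solution_linear; assumption. }
  { replace (-1 * c + 2 * c) with c by ring. field. }
  { rewrite HDe, HD. replace (-1 * c + 2 * c) with c by ring. field. }
  destruct (HS (Derive x c) (fun t => / 2 * x t + - / 2 * x (-1 * t + 2 * c))) as [O0 O1].
  { apply hill_solution_linear; assumption. }
  { replace (-1 * c + 2 * c) with c by ring. field. }
  { rewrite HDo, HD. replace (-1 * c + 2 * c) with c by ring. field. }
  rewrite HDe in E1. rewrite HDo in O1. split; lra.
Qed.

(** Reflection about [h] carries [c] to [2 h - c], one period further on. Passing through the data
    at [h] shows that the form agrees at these two points, and translation by periods does the
    rest. *)
Lemma hill_period_invariant (a : R -> R) (B c h : R) :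
  (forall t, 0 <= a t <= B) ->
  (forall t, a (-1 * t + 2 * c) = a t) -> (forall t, a (-1 * t + 2 * h) = a t) ->
  (forall x, hill_solution a x -> x c = 1 -> Derive x c = 0 -> 0 < x h /\ Derive x h < 0) ->
  (forall x, hill_solution a x -> x c = 0 -> Derive x c = 1 -> 0 < x h /\ 0 < Derive x h) ->
  exists p q, 0 < p /\ 0 < q /\
    forall (x : R -> R) (k : nat), hill_solution a x ->
      p * x (c + INR k * (2 * (h - c))) ^ 2 + q * Derive x (c + INR k * (2 * (h - c))) ^ 2
      = p * x c ^ 2 + q * Derive x c ^ 2.
Proof.
  intros Ha Hc Hh Heven Hodd.
  destruct (hill_transfer a B c h Ha Hc Heven Hodd)
    as (c1 & c2 & s1 & s2 & Hc1 & Hc2 & Hs1 & Hs2 & HT).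
  exists (c1 * c2), (s1 * s2).
  split; [apply Rmult_lt_0_compat; assumption|].
  split; [apply Rmult_lt_0_compat; assumption|].
  (* Up to the factor [c1 s2 + c2 s1], the form is carried to
     [c2 s2 x(h)^2 + c1 s1 x'(h)^2], which has no cross term and is therefore
     unchanged by the reflection about [h]. *)
  assert (Hhalf : forall x, hill_solution a x ->
    (c1 * s2 + c2 * s1) * (c1 * c2 * x c ^ 2 + s1 * s2 * Derive x c ^ 2)
    = c2 * s2 * x h ^ 2 + c1 * s1 * Derive x h ^ 2).
  { intros x Hx. destruct (HT x Hx) as [-> ->]. ring. }
  assert (Hone : forall x, hill_solution a x ->
    c1 * c2 * x (-1 * c + 2 * h) ^ 2 + s1 * s2 * Derive x (-1 * c + 2 * h) ^ 2
    = c1 * c2 * x c ^ 2 + s1 * s2 * Derive x c ^ 2).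
  { intros x Hx.
    destruct (second_derivative_affine (-1) (2 * h) _ _ Hx) as [_ HD].
    pose proof (Hhalf x Hx) as H1.
    pose proof (Hhalf (fun t => x (-1 * t + 2 * h))) as H2.
    rewrite !HD in H2. replace (-1 * h + 2 * h) with h in H2 by ring.
    specialize (H2 ltac:(apply hill_solution_affine; [ring | assumption | assumption])).
    apply (Rmult_eq_reg_l (c1 * s2 + c2 * s1)); [|nra].
    rewrite H1. etransitivity; [|etransitivity; [exact H2|]]; ring. }
  intros x k; revert x. induction k as [|k IH]; intros x Hx.
  - simpl INR. replace (c + 0 * (2 * (h - c))) with c by ring. reflexivity.
  - destruct (second_derivative_affine 1 (2 * (h - c)) _ _ Hx) as [_ HD].
    assert (Hy : hill_solution a (fun t => x (1 * t + 2 * (h - c)))).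
    { apply hill_solution_affine; [ring | | assumption].
      (* The reflections about [c] and [h] compose to the translation by [2 (h - c)], which is
         therefore a period of [a]. *)
      intros t. rewrite <- (Hh (1 * t + 2 * (h - c))), <- (Hc t). f_equal. ring. }
    specialize (IH _ Hy). rewrite !HD in IH. rewrite S_INR.
    replace (1 * (c + INR k * (2 * (h - c))) + 2 * (h - c))
      with (c + (INR k + 1) * (2 * (h - c))) in IH by ring.
    replace (1 * c + 2 * (h - c)) with (-1 * c + 2 * h) in IH by ring.
    rewrite !Rmult_1_l in IH. rewrite IH. apply Hone, Hx.
Qed.

(** * From the invariant form to stability *)

Lemma hill_zero_stable_of_phase_bound (a : R -> R) :
  (forall t0, exists M, forall x t, hill_solution a x -> phase_norm x t <= M * phase_norm x t0) ->
  hill_zero_stable a.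
Proof.
  intros H t0 eps Heps. destruct (H t0) as [M0 HM].
  set (M := Rmax M0 1).
  assert (HM1 : 1 <= M) by apply Rmax_r.
  assert (HM0 : M0 <= M) by apply Rmax_l.
  (* With [d] denoting this value, initial data below [d] have squared norm below [2 d^2], and
     [M * (2 d^2) <= (2 M d)^2 = eps^2] because [M >= 1]. *)
  exists (eps / (2 * M)).
  assert (Hd : 0 < eps / (2 * M)) by (apply Rdiv_lt_0_compat; lra).
  split; [exact Hd|].
  set (d := eps / (2 * M)) in *.
  assert (Hde : eps = 2 * M * d) by (unfold d; field; lra).
  intros x Hx H0 H1 t.
  specialize (HM x t Hx). unfold phase_norm in HM.
  apply Rabs_def2 in H0. apply Rabs_def2 in H1.
  assert (Hsum : x t0 ^ 2 + Derive x t0 ^ 2 < 2 * d ^ 2) by nra.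
  assert (Hlt : x t ^ 2 + Derive x t ^ 2 < eps ^ 2).
  { apply Rle_lt_trans with (M * (x t0 ^ 2 + Derive x t0 ^ 2)).
    { eapply Rle_trans; [exact HM|]. apply Rmult_le_compat_r; [nra | exact HM0]. }
    apply Rlt_le_trans with (M * (2 * d ^ 2)).
    { apply Rmult_lt_compat_l; [lra | exact Hsum]. }
    rewrite Hde. replace ((2 * M * d) ^ 2) with (M * (2 * d ^ 2) * (2 * M)) by ring.
    assert (0 <= M * (2 * d ^ 2)) by nra. nra. }
  pose proof (pow2_ge_0 (x t)). pose proof (pow2_ge_0 (Derive x t)).
  split; apply Rabs_def1; nra.
Qed.

Lemma hill_symmetric_stable (a : R -> R) (B c h : R) :
  c < h -> (forall t, 0 <= a t <= B) ->
  (forall t, a (-1 * t + 2 * c) = a t) -> (forall t, a (-1 * t + 2 * h) = a t) ->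
  (forall x, hill_solution a x -> x c = 1 -> Derive x c = 0 -> 0 < x h /\ Derive x h < 0) ->
  (forall x, hill_solution a x -> x c = 0 -> Derive x c = 1 -> 0 < x h /\ 0 < Derive x h) ->
  hill_zero_stable a.
Proof.
  intros Hch Ha Hc Hh Heven Hodd.
  destruct (hill_period_invariant a B c h Ha Hc Hh Heven Hodd) as (p & q & Hp & Hq & Hinv).
  assert (HB : 0 <= B) by (specialize (Ha 0); lra).
  set (L := 2 * (h - c)) in *.
  assert (HL : 0 < L) by (unfold L; lra).
  (* The factor [(p + q) (1/p + 1/q)] is the cost of passing from the Euclidean norm to the
     invariant form and back; the exponential is the growth over at most one period. *)
  set (M := (p + q) * (/ p + / q) * exp ((1 + B) * L)).
  pose proof (Rinv_0_lt_compat p Hp) as Hip. pose proof (Rinv_0_lt_compat q Hq) as Hiq.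
  assert (Hcomp : forall u v u' v', p * u ^ 2 + q * v ^ 2 = p * u' ^ 2 + q * v' ^ 2 ->
            u ^ 2 + v ^ 2 <= (p + q) * (/ p + / q) * (u' ^ 2 + v' ^ 2)).
  { intros u v u' v' H.
    pose proof (pow2_ge_0 u). pose proof (pow2_ge_0 v).
    pose proof (pow2_ge_0 u'). pose proof (pow2_ge_0 v').
    set (Q := p * u ^ 2 + q * v ^ 2) in *.
    assert (Hpu : 0 <= p * u ^ 2) by (apply Rmult_le_pos; lra).
    assert (Hqv : 0 <= q * v ^ 2) by (apply Rmult_le_pos; lra).
    assert (HQ : Q <= (p + q) * (u' ^ 2 + v' ^ 2)) by nra.
    apply Rle_trans with ((/ p + / q) * Q).
    - replace (u ^ 2 + v ^ 2) with (/ p * (p * u ^ 2) + / q * (q * v ^ 2)) by (field; lra).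
      unfold Q. nra.
    - replace ((p + q) * (/ p + / q) * (u' ^ 2 + v' ^ 2))
        with ((/ p + / q) * ((p + q) * (u' ^ 2 + v' ^ 2))) by ring.
      apply Rmult_le_compat_l; lra. }
  assert (Hright : forall x t, hill_solution a x -> c <= t -> phase_norm x t <= M * phase_norm x c).
  { intros x t Hx Ht.
    (* The last point [c + k L] not after [t] is at distance less than [L] from it. *)
    destruct (nfloor_ex ((t - c) / L)) as [k [Hk1 Hk2]].
    { apply Rdiv_le_0_compat; lra. }
    assert (E : t - c = (t - c) / L * L) by (field; lra).
    specialize (Hinv x k Hx). apply Hcomp in Hinv.
    set (s := c + INR k * L) in *.
    assert (Hs : s <= t <= s + L) by (unfold s; nra).
    pose proof (phase_norm_growth a x B s t Ha Hx) as HG.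
    assert (He : exp ((1 + B) * Rabs (t - s)) <= exp ((1 + B) * L)).
    { assert (Rabs (t - s) <= L) by (rewrite Rabs_right; lra).
      assert (Hle : (1 + B) * Rabs (t - s) <= (1 + B) * L) by (apply Rmult_le_compat_l; lra).
      destruct Hle as [Hlt | ->]; [apply Rlt_le, exp_increasing, Hlt | apply Rle_refl]. }
    pose proof (exp_pos ((1 + B) * L)).
    eapply Rle_trans; [exact HG|].
    unfold M. rewrite (Rmult_assoc _ (exp _)), (Rmult_comm (exp _)), <- Rmult_assoc.
    apply Rmult_le_compat; [unfold phase_norm; nra | apply Rlt_le, exp_pos | exact Hinv | exact He]. }
  assert (Hall : forall x t, hill_solution a x -> phase_norm x t <= M * phase_norm x c).
  { intros x t Hx. destruct (Rle_lt_dec c t) as [Ht | Ht]; [apply Hright; assumption|].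
    (* Times before [c] are reflected about [c] into the case already treated. *)
    destruct (second_derivative_affine (-1) (2 * c) _ _ Hx) as [_ HD].
    assert (Hy : hill_solution a (fun r => x (-1 * r + 2 * c))).
    { apply hill_solution_affine; [ring | assumption | assumption]. }
    pose proof (Hright _ (-1 * t + 2 * c) Hy ltac:(lra)) as H.
    unfold phase_norm in H |- *. rewrite !HD in H.
    replace (-1 * (-1 * t + 2 * c) + 2 * c) with t in H by ring.
    replace (-1 * c + 2 * c) with c in H by ring.
    etransitivity; [|etransitivity; [exact H|]]; right; ring. }
  apply hill_zero_stable_of_phase_bound.
  intros t0. exists (M * exp ((1 + B) * Rabs (c - t0))).
  intros x t Hx. eapply Rle_trans; [apply Hall, Hx|].
  rewrite Rmult_assoc. apply Rmult_le_compat_l.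
  - unfold M. apply Rmult_le_pos; [nra | apply Rlt_le, exp_pos].
  - rewrite Rmult_comm. apply (phase_norm_growth a); assumption.
Qed.

(** * Oscillation when the potential is bounded below *)

(** A solution positive from [T] on would be concave, hence nondecreasing, since a negative slope
    would force a zero. It would then stay above [y T], so [y'' <= - k * y T] and the slope would
    become negative after all. *)
Lemma hill_oscillates (b y : R -> R) (k : R) :
  0 < k -> (forall t, k <= b t) -> hill_solution b y ->
  forall T, exists z, T <= z /\ y z = 0.
Proof.
  intros Hk Hb.
  assert (Hpos : forall y, hill_solution b y -> forall T, 0 < y T ->
            exists z, T <= z /\ y z = 0).
  { clear y. intros y Hy T HT. apply NNPP. intros Hno.
    assert (Hy0 : forall t, T <= t -> 0 < y t).
    { intros t Ht. apply Rnot_le_lt. intros Hle.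
      destruct (first_zero y T t) as [z [Hz [Hyz _]]]; [| |assumption|assumption|].
      - intros s. apply (second_derivative_continuous _ _ s Hy).
      - destruct Ht as [|<-]; [assumption | lra].
      - apply Hno. exists z. split; [lra | exact Hyz]. }
    assert (Hdec : forall s t, T <= s < t -> Derive y t < Derive y s).
    { intros s t Hst.
      apply (derive_neg_lt (Derive y) (fun t => - (b t * y t))); [lra| |].
      - intros r. apply Hy.
      - intros r Hr. specialize (Hy0 r ltac:(lra)). specialize (Hb r). nra. }
    assert (Hdy : forall t, T <= t -> 0 <= Derive y t).
    { intros s Hs. apply Rnot_lt_le. intros Hneg.
      (* The tangent at [s] meets the axis at [s + l], and the graph lies below it. *)
      set (l := y s / - Derive y s).
      assert (Hl : 0 < l) by (apply Rdiv_lt_0_compat; [apply Hy0, Hs | lra]).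
      assert (E : y s + Derive y s * l = 0) by (unfold l; field; lra).
      destruct (MVT_cor2 y (Derive y) s (s + l)) as [r [Hr Hrs]]; [lra| |].
      { intros t _. apply is_derive_Reals, Hy. }
      specialize (Hdec s r ltac:(lra)). specialize (Hy0 (s + l) ltac:(lra)). nra. }
    assert (Hinc : forall t, T <= t -> y T <= y t).
    { intros t [Ht | <-]; [|lra].
      destruct (MVT_cor2 y (Derive y) T t Ht) as [r [Hr Hrt]].
      { intros s _. apply is_derive_Reals, Hy. }
      specialize (Hdy r ltac:(lra)). nra. }
    (* Over this length the slope drops by at least [Derive y T + 1], ending at or below [-1]. *)
    set (l := (Derive y T + 1) / (k * y T)).
    assert (Hky : 0 < k * y T) by (apply Rmult_lt_0_compat; assumption).
    assert (Hl : 0 < l).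
    { apply Rdiv_lt_0_compat; [|exact Hky]. specialize (Hdy T ltac:(lra)). lra. }
    assert (E : k * y T * l = Derive y T + 1) by (unfold l; field; lra).
    destruct (MVT_cor2 (Derive y) (fun t => - (b t * y t)) T (T + l)) as [r [Hr Hrt]]; [lra| |].
    { intros s _. apply is_derive_Reals, Hy. }
    specialize (Hdy (T + l) ltac:(lra)). specialize (Hinc r ltac:(lra)). specialize (Hb r).
    assert (Hby : k * y T <= b r * y r) by (apply Rmult_le_compat; lra).
    nra. }
  intros Hy T.
  destruct (Rtotal_order (y T) 0) as [Hlt | [Heq | Hgt]].
  - destruct (Hpos (fun t => -1 * y t + 0 * y t)) with (T := T) as [z [Hz Hyz]].
    + apply hill_solution_linear; assumption.
    + lra.
    + exists z. split; [exact Hz | lra].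
  - exists T. split; [lra | exact Heq].
  - apply Hpos; assumption.
Qed.

(** * The Duffing equation: energy, uniqueness and symmetries *)

(** The Duffing equation is the case [al = m^2 (m^2 - P)], [be = m^4]. *)
Definition cubic_solution (al be : R) (x : R -> R) : Prop :=
  second_derivative x (fun t => - (al * x t + be * x t ^ 3)).

(** Freezing the solution inside the potential makes the linear oscillation and comparison results
    available for it. *)
Lemma cubic_solution_hill (al be : R) (x : R -> R) :
  cubic_solution al be x -> hill_solution (fun t => al + be * x t ^ 2) x.
Proof. apply second_derivative_ext. intros t. ring. Qed.

Lemma cubic_energy_constant (al be : R) (x : R -> R) (s t : R) :
  cubic_solution al be x ->
  Derive x t ^ 2 / 2 + al / 2 * x t ^ 2 + be / 4 * x t ^ 4
  = Derive x s ^ 2 / 2 + al / 2 * x s ^ 2 + be / 4 * x s ^ 4.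
Proof.
  intros Hx.
  set (E := fun t => Derive x t ^ 2 / 2 + al / 2 * x t ^ 2 + be / 4 * x t ^ 4).
  assert (HE : forall r, is_derive E r 0).
  { intros r. destruct (Hx r) as [D1 D2].
    assert (P2 : derivable_pt_lim (fun t => Derive x t ^ 2) r
              (INR 2 * - (al * x r + be * x r ^ 3) * Derive x r ^ 1)).
    { apply is_derive_Reals, is_derive_pow, D2. }
    assert (Q2 : derivable_pt_lim (fun t => x t ^ 2) r (INR 2 * Derive x r * x r ^ 1)).
    { apply is_derive_Reals, is_derive_pow, D1. }
    assert (Q4 : derivable_pt_lim (fun t => x t ^ 4) r (INR 4 * Derive x r * x r ^ 3)).
    { apply is_derive_Reals, is_derive_pow, D1. }
    assert (HEt : forall t, / 2 * Derive x t ^ 2 + al / 2 * x t ^ 2 + be / 4 * x t ^ 4 = E t).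
    { intros t'. unfold E. field. }
    apply (is_derive_ext _ _ _ _ HEt), is_derive_Reals.
    replace 0 with (/ 2 * (INR 2 * - (al * x r + be * x r ^ 3) * Derive x r ^ 1)
                    + al / 2 * (INR 2 * Derive x r * x r ^ 1)
                    + be / 4 * (INR 4 * Derive x r * x r ^ 3)) by (simpl; field).
    apply (derivable_pt_lim_plus (fun t => / 2 * Derive x t ^ 2 + al / 2 * x t ^ 2)
                                 (fun t => be / 4 * x t ^ 4)).
    - apply (derivable_pt_lim_plus (fun t => / 2 * Derive x t ^ 2) (fun t => al / 2 * x t ^ 2)).
      + apply (derivable_pt_lim_scal (fun t => Derive x t ^ 2)), P2.
      + apply (derivable_pt_lim_scal (fun t => x t ^ 2)), Q2.
    - apply (derivable_pt_lim_scal (fun t => x t ^ 4)), Q4. }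
  change (E t = E s).
  destruct (Rle_lt_dec s t) as [Hst | Hst].
  - apply Rle_antisym.
    + apply Ropp_le_cancel. apply (derive_nonneg_le (fun r => - E r) (fun _ => - 0)); [lra| |].
      * intros r. apply (is_derive_opp E), HE.
      * intros r. lra.
    + apply (derive_nonneg_le E (fun _ => 0)); [lra | exact HE | intros; lra].
  - apply Rle_antisym.
    + apply (derive_nonneg_le E (fun _ => 0)); [lra | exact HE | intros; lra].
    + apply Ropp_le_cancel. apply (derive_nonneg_le (fun r => - E r) (fun _ => - 0)); [lra| |].
      * intros r. apply (is_derive_opp E), HE.
      * intros r. lra.
Qed.

Lemma cubic_bounded (al be : R) (x : R -> R) :
  0 < al -> 0 < be -> cubic_solution al be x -> exists B, forall t, x t ^ 2 <= B.
Proof.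
  intros Hal Hbe Hx.
  set (E := Derive x 0 ^ 2 / 2 + al / 2 * x 0 ^ 2 + be / 4 * x 0 ^ 4).
  exists (2 * E / al). intros t.
  pose proof (cubic_energy_constant al be x 0 t Hx) as H. fold E in H.
  pose proof (pow2_ge_0 (Derive x t)). pose proof (pow2_ge_0 (x t ^ 2)).
  apply (Rmult_le_reg_l al); [exact Hal|].
  replace (al * (2 * E / al)) with (2 * E) by (field; lra).
  replace (x t ^ 4) with ((x t ^ 2) ^ 2) in H by ring. nra.
Qed.

(** By the factorisation of [x^3 - y^3], the difference [x - y] solves a Hill equation with
    coefficient [al + be (x^2 + x y + y^2)], which is nonnegative and, by conservation of energy,
    bounded. *)
Lemma cubic_unique (al be : R) (x y : R -> R) (s : R) :
  0 < al -> 0 < be -> cubic_solution al be x -> cubic_solution al be y ->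
  x s = y s -> Derive x s = Derive y s -> forall t, x t = y t /\ Derive x t = Derive y t.
Proof.
  intros Hal Hbe Hx Hy H0 H1 t.
  destruct (cubic_bounded al be x Hal Hbe Hx) as [Bx HBx].
  destruct (cubic_bounded al be y Hal Hbe Hy) as [By HBy].
  destruct (second_derivative_linear 1 (-1) _ _ _ _ Hx Hy) as [HS HD].
  destruct (hill_unique_zero (fun r => al + be * (x r ^ 2 + x r * y r + y r ^ 2))
              (fun r => 1 * x r + -1 * y r) (al + be * (2 * (Bx + By))) s) with (t := t)
    as [E0 E1].
  - intros r. specialize (HBx r). specialize (HBy r).
    pose proof (pow2_ge_0 (x r + y r)). pose proof (pow2_ge_0 (x r - y r)).
    pose proof (pow2_ge_0 (x r)). pose proof (pow2_ge_0 (y r)).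
    assert (0 <= x r ^ 2 + x r * y r + y r ^ 2 <= 2 * (Bx + By)) by (split; lra).
    split; nra.
  - eapply second_derivative_ext; [|exact HS]. intros r. simpl. ring.
  - rewrite H0. ring.
  - rewrite HD, H1. ring.
  - rewrite HD in E1. split; lra.
Qed.

Lemma cubic_even (al be : R) (x : R -> R) (c : R) :
  0 < al -> 0 < be -> cubic_solution al be x -> Derive x c = 0 ->
  forall t, x (-1 * t + 2 * c) = x t.
Proof.
  intros Hal Hbe Hx Hc t.
  destruct (second_derivative_affine (-1) (2 * c) _ _ Hx) as [HS HD].
  apply (cubic_unique al be (fun t => x (-1 * t + 2 * c)) x c Hal Hbe); [|assumption| |].
  - eapply second_derivative_ext; [|exact HS]. intros r. simpl. ring.
  - f_equal. ring.
  - rewrite HD. replace (-1 * c + 2 * c) with c by ring. rewrite Hc. ring.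
Qed.

Lemma cubic_odd (al be : R) (x : R -> R) (h : R) :
  0 < al -> 0 < be -> cubic_solution al be x -> x h = 0 ->
  forall t, x (-1 * t + 2 * h) = - x t /\ Derive x (-1 * t + 2 * h) = Derive x t.
Proof.
  intros Hal Hbe Hx Hh t.
  destruct (second_derivative_affine (-1) (2 * h) _ _ Hx) as [HS HD].
  destruct (second_derivative_linear (-1) 0 _ _ _ _ HS HS) as [HS' HD'].
  destruct (cubic_unique al be
    (fun t => -1 * x (-1 * t + 2 * h) + 0 * x (-1 * t + 2 * h)) x h Hal Hbe) with (t := t)
    as [E0 E1]; [|assumption| | |].
  - eapply second_derivative_ext; [|exact HS']. intros r. simpl. ring.
  - replace (-1 * h + 2 * h) with h by ring. rewrite Hh. ring.
  - rewrite HD', HD. replace (-1 * h + 2 * h) with h by ring. ring.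
  - rewrite HD', HD in E1. split; lra.
Qed.

(** Rolle's theorem between two zeros gives a critical point. Positive energy keeps [x] from
    vanishing there, and if [x] is negative there, odd symmetry about a zero supplies a positive
    one. *)
Lemma cubic_positive_critical_point (al be : R) (x : R -> R) :
  0 < al -> 0 < be -> cubic_solution al be x ->
  0 < Derive x 0 ^ 2 / 2 + al / 2 * x 0 ^ 2 + be / 4 * x 0 ^ 4 ->
  exists c, Derive x c = 0 /\ 0 < x c.
Proof.
  intros Hal Hbe Hx HE.
  assert (Hosc : forall T, exists z, T <= z /\ x z = 0).
  { apply (hill_oscillates (fun t => al + be * x t ^ 2) x al Hal).
    - intros t. pose proof (pow2_ge_0 (x t)). nra.
    - apply cubic_solution_hill, Hx. }
  (* Searching from [z1 + 1] makes the second zero distinct from the first. *)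
  destruct (Hosc 0) as [z1 [_ Hz1]]. destruct (Hosc (z1 + 1)) as [z2 [Hz12 Hz2]].
  destruct (MVT_cor2 x (Derive x) z1 z2) as [c [Hc _]]; [lra| |].
  { intros t _. apply is_derive_Reals, Hx. }
  assert (Hc0 : Derive x c = 0) by nra.
  rewrite (cubic_energy_constant al be x c 0 Hx), Hc0 in HE.
  destruct (Rtotal_order (x c) 0) as [Hlt | [Heq | Hgt]].
  - exists (-1 * c + 2 * z1).
    destruct (cubic_odd al be x z1 Hal Hbe Hx Hz1 c) as [-> ->]. split; lra.
  - rewrite Heq in HE. lra.
  - exists c. split; assumption.
Qed.

(** * Stability for every positive energy *)

Lemma cubic_hill_stable (al be ga de : R) (x : R -> R) :
  0 <= ga < al -> 0 < de <= be -> cubic_solution al be x ->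
  0 < Derive x 0 ^ 2 / 2 + al / 2 * x 0 ^ 2 + be / 4 * x 0 ^ 4 ->
  hill_zero_stable (fun t => ga + de * x t ^ 2).
Proof.
  intros Hga Hde Hx HE.
  assert (Hal : 0 < al) by lra. assert (Hbe : 0 < be) by lra.
  destruct (cubic_positive_critical_point al be x Hal Hbe Hx HE) as [c [Hc Hxc]].
  pose proof (cubic_solution_hill al be x Hx) as Hxh.
  destruct (hill_oscillates (fun t => al + be * x t ^ 2) x al Hal) with (T := c)
    as [z [Hz Hxz]]; [|exact Hxh|].
  { intros t. pose proof (pow2_ge_0 (x t)). nra. }
  destruct (first_zero x c z) as [h [[Hch _] [Hh Hpos]]]; [| |assumption|lra|].
  { intros t. apply (second_derivative_continuous _ _ t Hx). }
  { destruct Hz as [|<-]; [assumption | lra]. }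
  destruct (cubic_bounded al be x Hal Hbe Hx) as [B HB].
  apply (hill_symmetric_stable _ (ga + de * B) c h Hch).
  - intros t. specialize (HB t). pose proof (pow2_ge_0 (x t)). split; nra.
  - intros t. rewrite (cubic_even al be x c Hal Hbe Hx Hc). reflexivity.
  - intros t. destruct (cubic_odd al be x h Hal Hbe Hx Hh t) as [-> _]. ring.
  (* The comparison function is [x] itself: it is positive on [[c, h)], vanishes at [h] and has zero
     slope at [c]. Strict positivity of [x] on [(c, h)] keeps the Hill coefficient positive even if
     [ga = 0]. *)
  - intros y Hy. apply (hill_even_comparison (fun t => ga + de * x t ^ 2)
      (fun t => al + be * x t ^ 2) x); try assumption.
    + intros t Ht. specialize (Hpos t ltac:(lra)).
      assert (0 < x t ^ 2) by (apply pow_lt; exact Hpos). split; nra.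
    + lra.
  - (* [- x'] solves the linearised equation, whose potential [al + 3 be x^2]
       also dominates, and its derivative vanishes at [h] together with [x]. *)
    destruct (second_derivative_intro (fun t => - Derive x t)
      (fun t => al * x t + be * x t ^ 3)
      (fun t => - ((al + 3 * be * x t ^ 2) * - Derive x t))) as [Hw HDw].
    { intros t. rewrite <- (Ropp_involutive (al * x t + be * x t ^ 3)).
      apply (is_derive_opp (Derive x)), Hx. }
    { intros t. destruct (Hx t) as [D1 _].
      assert (Q3 : derivable_pt_lim (fun t => x t ^ 3) t (INR 3 * Derive x t * x t ^ 2)).
      { apply is_derive_Reals, is_derive_pow, D1. }
      rewrite is_derive_Reals in D1 |- *.
      replace (- ((al + 3 * be * x t ^ 2) * - Derive x t))
        with (al * Derive x t + be * (INR 3 * Derive x t * x t ^ 2)) by (simpl; ring).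
      apply (derivable_pt_lim_plus (fun t => al * x t) (fun t => be * x t ^ 3)).
      - apply (derivable_pt_lim_scal x), D1.
      - apply (derivable_pt_lim_scal (fun t => x t ^ 3)), Q3. }
    intros y Hy.
    apply (hill_odd_comparison (fun t => ga + de * x t ^ 2)
      (fun t => al + 3 * be * x t ^ 2) (fun t => - Derive x t));
      try assumption.
    + intros t Ht. pose proof (pow2_ge_0 (x t)). nra.
    + intros t Ht. enough (Derive x t < Derive x c) by lra.
      apply (derive_neg_lt (Derive x) (fun t => - (al * x t + be * x t ^ 3))); [lra| |].
      * intros r. apply Hx.
      * intros r Hr. specialize (Hpos r ltac:(lra)).
        assert (0 < x r ^ 3) by (apply pow_lt; exact Hpos). nra.
    + lra.
    + intros t Ht. rewrite HDw.
      assert (Hxt : 0 <= x t).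
      { destruct (proj2 Ht) as [Hlt | ->]; [apply Rlt_le, Hpos; lra | lra]. }
      assert (0 <= x t ^ 3) by (apply pow_le; exact Hxt). nra.
Qed.

Theorem theorem4 (m n : nat) (P : R)
    (hm : (1 <= m)%nat) (hn : (1 <= n)%nat)
    (hP0 : 0 <= P) (hPn : P <= INR n ^ 2) (hnm : INR n ^ 2 < INR m ^ 2) :
  exists E1 E2 : R, 0 < E1 /\ E1 <= E2 /\
    forall Theta : R -> R, duffing_solution m P Theta ->
      (0 < duffing_energy m P Theta <= E1 \/ E2 < duffing_energy m P Theta) ->
      linearly_stable m n P Theta.
Proof.
  (* All positive energies are stable, so any common positive threshold would do. *)
  exists 1, 1. split; [lra|]. split; [lra|].
  intros Theta HT HE.
  assert (HE0 : 0 < duffing_energy m P Theta) by lra.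
  assert (Hn : 0 < INR n ^ 2) by (apply pow_lt, lt_0_INR; lia).
  unfold linearly_stable, hill_coefficient.
  apply (cubic_hill_stable (INR m ^ 2 * (INR m ^ 2 - P)) (INR m ^ 4)).
  (* The products [n^2 (n^2 - P)] and [m^2 (m^2 - P)] compare factor by factor; the former is 0 when
     [P = n^2]. *)
  - split; nra.
  - replace (INR m ^ 4) with (INR m ^ 2 * INR m ^ 2) by ring. split; nra.
  - exact HT.
  - exact HE0.
Qed.
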